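(* Let $(\Omega,d)$ be a separable metric space, let $\widehat\Omega\subseteq\Omega$, let $P$ be a Markov transition kernel on $\Omega$, and let $\widehat P$ be a Markov transition kernel on $\widehat\Omega$ ($\widehat P$ is not assumed ergodic). Let $\varepsilon>0$. Suppose that for some real numbers $\lambda,C,\delta\geq 0$: 1. $\varrho_\lambda(\widehat P(x,\cdot),P(x,\cdot))\leq\delta$ for all $x\in\widehat\Omega$; 2. $\varrho_\lambda(P(x,\cdot),P(x',\cdot))\leq C\,d(x,x')$ for all $x,x'\in\Omega$; 3. the Markov chain defined by $P$ is ergodic, with stationary distribution $\pi$ and variation threshold time $\tau_1$. Let $t_\varepsilon:=\lceil \ln(2e/\varepsilon)\,\tau_1\rceil$. Then $\varrho_\lambda(\widehat P^t(x,\cdot),\pi)\leq\varepsilon$ for every $x\in\widehat\Omega$ and every $t\in\mathbb{N}$ with $t\geq t_\varepsilon$, provided that, additionally: - in the case $\lambda C<1$, $$\delta\leq\frac{(1-\lambda C)\varepsilon}{2t_\varepsilon};$$ - in the case $\lambda C=1$, $$\delta\leq\frac{\varepsilon}{t_\varepsilon(t_\varepsilon+1)};$$ - in the case $\lambda C>1$, $$\delta\leq\frac{(\lambda C-1)^2\varepsilon}{2(\lambda C)^{t_\varepsilon+1}}.$$ (A quotient with zero denominator is read as $+\infty$.)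
   Context: Here $\mathbb{N}=\{0,1,2,\ldots\}$. All measures on $\Omega$ are Borel probability measures, and $\widehat\Omega$ carries the trace of the Borel $\sigma$-algebra of $\Omega$. $P^t$ and $\widehat P^t$ denote the $t$-step transition kernels. For $x\in\widehat\Omega$, $\widehat P^t(x,\cdot)$ is regarded as a probability distribution on $\Omega$ by the convention $\widehat P^t(x,A):=\widehat P^t(x,A\cap\widehat\Omega)$. For $A\subseteq\Omega$ and $\eta\geq0$, put $d(y,A):=\inf\{d(y,x):x\in A\}$ and $A^\eta:=\{y\in\Omega:d(y,A)\leq\eta\}$ (with $\inf\emptyset=+\infty$). For $\lambda\geq0$, the parametric Prohorov metric between Borel probability measures $\mu,\mu'$ on $\Omega$ is $$\varrho_\lambda(\mu,\mu'):=\inf\{\eta\geq 0:\mu(A)\leq\mu'(A^{\lambda\eta})+\eta\text{ for all closed }A\subseteq\Omega\}.$$ The total variation distance is $$\|\mu-\mu'\|_{\mathrm{TV}}:=\varrho_0(\mu,\mu')=\sup\{|\mu(A)-\mu'(A)|:A\subseteq\Omega\text{ closed}\}.$$ The variation threshold time of the Markov chain $(\Omega,P)$ is $$\tau_1:=\min\{t\in\mathbb{N}:\|P^t(x,\cdot)-P^t(x',\cdot)\|_{\mathrm{TV}}\leq e^{-1}\text{ for all }x,x'\in\Omega\},$$ which is assumed to exist (be finite). Ergodic is meant in the usual sense for Markov chains: $P$ has a stationary distribution $\pi$, and $P^t(x,\cdot)\to\pi$ in total variation as $t\to\infty$ for every $x\in\Omega$. *)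

(* Defs.v *)
From HB Require Import structures.
From mathcomp Require Import all_boot all_order all_algebra.
From mathcomp Require Import all_classical all_reals all_analysis.

Set Implicit Arguments.
Unset Strict Implicit.
Unset Printing Implicit Defensive.

Import Order.TTheory GRing.Theory Num.Theory.
Import numFieldNormedType.Exports.

Local Open Scope classical_set_scope.
Local Open Scope ring_scope.
Local Open Scope ereal_scope.

(* [measurableType] requires a default point, hence nonempty metric spaces. *)
#[short(type="pointedMetricType")]
HB.structure Definition PointedMetric (K : numDomainType) :=
  {M of Pointed M & Metric K M}.

Definition separable (T : topologicalType) : Prop :=
  exists2 S : set T, countable S & dense S.

Definition borel (T : ptopologicalType) : measurableType (@open T).-sigma :=
  g_sigma_algebraType (@open T).

(* The witness [A0] only provides the default point. *)
Definition nonempty_subset (T : Type) (A : set T) (A0 : A !=set0) : Type := A.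

HB.instance Definition _ (T : choiceType) (A : set T) (A0 : A !=set0) :=
  Choice.copy (nonempty_subset A0) (set_type A).
HB.instance Definition _ (T : choiceType) (A : set T) (A0 : A !=set0) :=
  isPointed.Build (nonempty_subset A0) (SigSub (mem_set (svalP (cid A0)))).

Definition trace_val (T : ptopologicalType) (A : set T) (A0 : A !=set0) :
  nonempty_subset A0 -> borel T := @set_val T A.
Arguments trace_val {T A} A0 x.

(* The measurable sets are the preimages under the inclusion of the Borel sets
   of [T], i.e. the sets [A `&` B] with [B] Borel; [A] itself is arbitrary. *)
Definition trace_borel (T : ptopologicalType) (A : set T) (A0 : A !=set0) :
    measurableType (preimage_display (trace_val A0)) :=
  g_sigma_algebra_preimageType (trace_val A0).

(* A measure on the subspace regarded as a measure on the whole space: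
   [B] has measure [mu (B `&` A)]. *)
Section extend.
Context {R : realType} {T : ptopologicalType} {A : set T} {A0 : A !=set0}.
Variable mu : {measure set (trace_borel A0) -> \bar R}.

Definition extend (B : set (borel T)) : \bar R := mu (trace_val A0 @^-1` B).

Let measurable_preim (B : set (borel T)) : measurable B ->
  measurable (trace_val A0 @^-1` B : set (trace_borel A0)).
Proof. by move=> mB; exists B => //; rewrite setTI. Qed.

Let extend0 : extend set0 = 0.
Proof. by rewrite /extend preimage_set0 measure0. Qed.

Let extend_ge0 B : 0 <= extend B.
Proof. exact: measure_ge0. Qed.

Let extend_sigma_additive : semi_sigma_additive extend.
Proof.
move=> F mF tF mUF; rewrite /extend preimage_bigcup.
apply: measure_semi_sigma_additive.
- by move=> n; exact: measurable_preim.
- apply/trivIsetP => /= i j _ _ ij; rewrite -preimage_setI.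
  by move/trivIsetP : tF => /(_ _ _ _ _ ij) ->//; rewrite preimage_set0.
- by rewrite -preimage_bigcup; exact: measurable_preim.
Qed.

HB.instance Definition _ := isMeasure.Build _ _ _ extend
  extend0 extend_ge0 extend_sigma_additive.

End extend.

Section kernel_powers.
Context {d} {X : measurableType d} {R : realType}.

Section comp.
Variables P Q : R.-pker X ~> X.

Let mkcomp_setT x : mkcomp_noparam P Q x setT = 1.
Proof.
rewrite [LHS]/=/mkcomp_noparam /kcomp_noparam.
transitivity (\int[P x]_y (cst 1 y)).
  by apply: eq_integral => y _; exact: prob_kernel.
by rewrite integral_cst// mul1e prob_kernel.
Qed.

HB.instance Definition _ := isProbabilityKernel.Build _ _ X X R
  (mkcomp_noparam P Q) mkcomp_setT.
End comp.

Fixpoint kpow (P : R.-pker X ~> X) (t : nat) : R.-pker X ~> X :=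
  if t is t'.+1 then mkcomp_noparam P (kpow P t')
  else kdirac (@measurable_id _ X setT).

Definition stationary (P : R.-pker X ~> X) (pi : probability X R) : Prop :=
  forall A, measurable A -> \int[pi]_x P x A = pi A.

End kernel_powers.

Section prohorov.
Context {R : realType} {T : pointedMetricType R}.
Implicit Types (A : set T) (mu nu : {measure set (borel T) -> \bar R}).

(* equal to [+oo] when [A] is empty *)
Definition dist_set (y : T) A : \bar R :=
  ereal_inf [set (mdist y x)%:E | x in A].

Definition enlargement A (eta : R) : set T :=
  [set y | dist_set y A <= eta%:E].

(* For probability measures [eta = 1] belongs to the set, so the real-valued
   infimum is the genuine one. *)
Definition prohorov (lambda : R) mu nu : R :=
  inf [set eta : R | (0 <= eta)%R /\ forall A, closed A ->
    mu A <= nu (enlargement A (lambda * eta)) + eta%:E].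

Definition tv mu nu : R := prohorov 0 mu nu.

Definition variation_threshold (P : R.-pker borel T ~> borel T) (tau : nat) :=
  let small t := forall x x', (tv (kpow P t x) (kpow P t x') <= (expR 1)^-1)%R in
  small tau /\ forall t, small t -> (tau <= t)%N.

Definition ergodic (P : R.-pker borel T ~> borel T)
    (pi : probability (borel T) R) : Prop :=
  stationary P pi /\
  forall x, tv (kpow P t x) pi @[t --> \oo] --> (0 : R)%R.

End prohorov.

(* Main.v *)
From HB Require Import structures.
Require Import Defs.
From mathcomp Require Import all_boot all_order all_algebra.
From mathcomp Require Import all_classical all_reals all_analysis.
From mathcomp Require Import measurable_realfun ring lra.

Set Implicit Arguments.
Unset Strict Implicit.
Unset Printing Implicit Defensive.

Import Order.TTheory GRing.Theory Num.Theory.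
Import numFieldNormedType.Exports.

Local Open Scope classical_set_scope.
Local Open Scope ring_scope.
Local Open Scope ereal_scope.

(** Write [q = lambda * C].  The idea is to follow the two chains side by side,
    as if they were coupled, and to record two numbers at time [t]: a distance
    [lambda * a t] and a probability [b t] such that the states are within that
    distance except with that probability.  One step of the chains adds
    [delta] to the scale and, by the Lipschitz condition, multiplies the
    previous scale by [q]; hence [a t = delta * (1 + q + ... + q ^ (t - 1))].
    The probabilities of separation add up: [b t = a 1 + ... + a t].  Each of the
    three bounds on [delta] implies that [b t <= eps / 2] at the time [t_eps].
    The unperturbed chain is then within [eps / 2] of [pi] in total variation,
    and the two errors add up to [eps].

    No coupling is actually constructed.  The pair (distance, probability) is
    carried by [dominated_near r b mu nu], the inequality that defines the
    Prohorov metric with a radius and a defect that are independent of each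
    other.  Its behaviour under a Lipschitz kernel ([dominated_near_push]) is
    obtained by duality: the integral of [Q x A] is an integral over [s] of the
    measures of the sets where [Q x A > s], and an [r]-neighbourhood of such a
    set is contained in the corresponding set for an enlargement of [A].
    Iterating this gives the Lipschitz constants of the powers of [P]
    ([lipschitz_kernel_kpow]) and the comparison of the two chains
    ([dominated_near_kpow]).

    For the mixing of [P], the maximal total variation distance between rows is
    submultiplicative in time ([tv_le_kpow_mul]), so it is at most [e ^ - k] at
    time [k * tau1].  Since the integrands that occur there are merely Borel,
    the inequality given for closed sets has first to be extended to Borel sets
    ([tv_tv_le]), which is the inner regularity of Borel probability measures on
    a metric space ([closed_inner_approx]).  Comparing [P ^ (k * tau1)] with
    later and later powers of [P], which converge to [pi], replaces the second
    row by [pi] ([tv_le_kpow_limit]).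

    Beyond [t_eps] the bound persists because a mixture of measures dominated
    near [pi] is dominated near [pi] ([dominated_near_kpow_ge]). *)

(** * Closed enlargements *)

Lemma mass1_le1 d (T : measurableType d) (R : realType)
    (mu : {measure set T -> \bar R}) (A : set T) :
  mu setT = 1 -> measurable A -> mu A <= 1.
Proof. by move=> <- mA; apply: le_measure; rewrite ?inE. Qed.

Section enlargement.
Context {R : realType} {T : pointedMetricType R}.
Implicit Types (A : set T) (r e : R).

(** The infimum that defines the distance to a set need not be attained, whence
    the slack [e]. *)
Lemma enlargementP A r y : enlargement A r y <->
  forall e, (0 < e)%R -> exists2 x, A x & (mdist y x < r + e)%R.
Proof.
split=> [yA e e0|yA].
  have /ereal_inf_lt[_ [x Ax <-]] : dist_set y A < (r + e)%:E.
    by rewrite (le_lt_trans yA)// lte_fin ltrDl.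
  by rewrite lte_fin => yx; exists x.
apply/lee_addgt0Pr => e e0; have [x Ax yx] := yA e e0.
apply: (@le_trans _ _ (mdist y x)%:E); last by rewrite -EFinD lee_fin ltW.
by apply: ereal_inf_lbound; exists x.
Qed.

Lemma sub_enlargement A r : (0 <= r)%R -> A `<=` enlargement A r.
Proof.
move=> r0 y Ay; apply/enlargementP => e e0; exists y => //.
by rewrite mdistxx ltr_wpDl.
Qed.

Lemma enlargement_le A r r' : (r <= r')%R ->
  enlargement A r `<=` enlargement A r'.
Proof. by move=> rr' y /le_trans; apply; rewrite lee_fin. Qed.

Lemma enlargementD A r r' :
  enlargement (enlargement A r) r' `<=` enlargement A (r + r').
Proof.
move=> y /enlargementP yA; apply/enlargementP => e e0.
have e20 : (0 < e / 2)%R by rewrite divr_gt0.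
have [z /enlargementP/(_ _ e20)[x Ax zx] yz] := yA _ e20.
exists x => //; apply: (le_lt_trans (metric_triangle y z x)).
by rewrite [e in ltRHS]splitr (addrC r) addrACA ltrD.
Qed.

Lemma closureP A y : closure A y <->
  forall e, (0 < e)%R -> exists2 x, A x & (mdist y x < e)%R.
Proof.
split=> [yA e e0|yA B].
  have [x [Ax yx]] := yA _ (nbhsx_ballx y e e0).
  by exists x => //; move: yx; rewrite ballEmdist.
move=> /nbhs_ballP[e /= e0 yeB]; have [x Ax yx] := yA _ e0.
by exists x; split=> //; apply: yeB; rewrite ballEmdist.
Qed.

Lemma enlargement0 A : enlargement A 0 = closure A.
Proof.
apply/seteqP; split=> y.
  move=> /enlargementP yA; apply/closureP => e /yA[x Ax].
  by rewrite add0r; exists x.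
move=> /closureP yA; apply/enlargementP => e /yA[x Ax].
by exists x => //; rewrite add0r.
Qed.

Lemma enlargement_closed0 A : closed A -> enlargement A 0 = A.
Proof. by move=> cA; rewrite enlargement0 -(closure_id A).1. Qed.

(** The closure is the enlargement of radius [0], so closedness is an instance
    of the addition of radii. *)
Lemma closed_enlargement A r : closed (enlargement A r).
Proof.
move=> y; rewrite -enlargement0 => /enlargementD.
by rewrite addr0.
Qed.

Lemma bigcap_enlargement A r :
  \bigcap_n enlargement A (r + n.+1%:R^-1) = enlargement A r.
Proof.
apply/seteqP; split=> y; last first.
  by move=> yA n _; apply: enlargement_le yA; rewrite lerDl invr_ge0.
move=> yA; apply/enlargementP => e e0.
have e20 : (0 < e / 2)%R by rewrite divr_gt0.
have [n ne] := ltr_add_invr (ltr_pwDr e20 (lexx 0%R)).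
have /enlargementP/(_ _ e20)[x Ax yx] := yA n Logic.I.
exists x => //; rewrite (lt_trans yx)// -addrA ltrD2l [ltRHS]splitr ltrD2r.
by move: ne; rewrite !add0r.
Qed.

Lemma measurable_closed A : closed A -> measurable (A : set (borel T)).
Proof.
move=> cA; rewrite -[A]setCK; apply: measurableC.
by apply: sub_sigma_algebra; exact: closed_openC.
Qed.

Lemma measurable_enlargement A r :
  measurable (enlargement A r : set (borel T)).
Proof. by apply: measurable_closed; exact: closed_enlargement. Qed.

End enlargement.

(** * The Prohorov inequality with independent radius and defect *)

(** The inequality inside the definition of the Prohorov metric, with the
    radius [r] and the defect [b] decoupled: in the course of the proof they
    grow at different rates. *)
Definition dominated_near {R : realType} {T : pointedMetricType R} (r b : R)
    (mu nu : {measure set (borel T) -> \bar R}) :=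
  forall A : set T, closed A -> mu A <= nu (enlargement A r) + b%:E.

Section dominated_near.
Context {R : realType} {T : pointedMetricType R}.
Implicit Types (mu nu rho : {measure set (borel T) -> \bar R}) (r b e : R).

Lemma dominated_near_le r b r' b' mu nu : (r <= r')%R -> (b <= b')%R ->
  dominated_near r b mu nu -> dominated_near r' b' mu nu.
Proof.
move=> rr' bb' H A cA; apply: (le_trans (H A cA)).
apply: leeD; last by rewrite lee_fin.
by apply: le_measure; rewrite ?inE; try exact: measurable_enlargement;
  exact: enlargement_le.
Qed.

Lemma dominated_near_trans r b r' b' mu nu rho :
  dominated_near r b mu nu -> dominated_near r' b' nu rho ->
  dominated_near (r + r') (b + b') mu rho.
Proof.
move=> H H' A cA; apply: (le_trans (H A cA)).
rewrite EFinD [b%:E + _]addeC addeA leeD2r//.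
apply: (le_trans (H' _ (@closed_enlargement _ _ A r))).
rewrite leeD2r//.
by apply: le_measure; rewrite ?inE; try exact: measurable_enlargement;
  exact: enlargementD.
Qed.

(** Arbitrarily small slack can be removed because the closed enlargements of
    radius [r + e] decrease to the one of radius [r]. *)
Lemma le_enlargement_slack nu A r b (c : \bar R) : nu setT = 1 ->
  (forall e, (0 < e)%R -> c <= nu (enlargement A (r + e)) + (b + e)%:E) ->
  c <= nu (enlargement A r) + b%:E.
Proof.
move=> nu1 H.
pose F n : set (borel T) := enlargement A (r + n.+1%:R^-1).
have fin_nu s : nu (enlargement A s) \is a fin_num.
  rewrite ge0_fin_numE// (le_lt_trans (mass1_le1 _ _)) ?ltry//.
  exact: measurable_enlargement.
have cvgF : nu (F n) @[n --> \oo] --> nu (enlargement A r).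
  rewrite -(bigcap_enlargement A r); apply: (nonincreasing_cvg_mu (F := F)).
  - by rewrite -ge0_fin_numE//; exact: fin_nu.
  - by move=> n; exact: measurable_enlargement.
  - rewrite (_ : \bigcap_n F n = enlargement A r); last exact: bigcap_enlargement.
    exact: measurable_enlargement.
  - move=> m n mn; apply/subsetPset; apply: enlargement_le.
    by rewrite lerD2l lef_pV2 ?posrE// ler_nat.
have cvgb : (b + n.+1%:R^-1)%:E @[n --> \oo] --> b%:E.
  apply: cvg_EFin; first by near=> n.
  rewrite -[X in _ --> X]addr0; apply: cvgD; first exact: cvg_cst.
  exact: cvg_harmonic.
apply: cvge_ge (cvgeD (fin_num_adde_defr b%:E (fin_nu r)) cvgF cvgb).
by near=> n; apply: H => //; rewrite invr_gt0.
Unshelve. all: by end_near. Qed.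

Variable lambda : R.
Hypothesis lambda_ge0 : (0 <= lambda)%R.

(** The infimum in the Prohorov metric is attained, since slack can be
    removed. *)
Lemma prohorov_dominated_near eta mu nu : mu setT = 1 -> nu setT = 1 ->
  (prohorov lambda mu nu <= eta)%R -> dominated_near (lambda * eta) eta mu nu.
Proof.
move=> mu1 nu1 le_eta A cA; apply: le_enlargement_slack => // e e0.
(* An admissible value within [e / (lambda + 1)] of the infimum keeps both the
   radius and the defect within [e] of their targets. *)
have l10 : (0 < lambda + 1)%R by rewrite ltr_wpDl.
set S := [set x : R | (0 <= x)%R /\ dominated_near (lambda * x) x mu nu].
have infS : has_inf S.
  split.
    exists 1%R; split=> // B cB; rewrite (le_trans (mass1_le1 _ _))//.
      exact: measurable_closed.
    by rewrite leeDr.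
  by exists 0%R => x [].
have e10 : (0 < e / (lambda + 1))%R by rewrite divr_gt0.
have [k [k0 Hk] kS] := inf_adherent e10 infS.
have kle : (k <= eta + e / (lambda + 1))%R.
  by rewrite (le_trans (ltW kS))// lerD2r.
apply: (dominated_near_le _ _ Hk) => //.
- rewrite (le_trans (ler_wpM2l lambda_ge0 kle))// mulrDr lerD2l.
  by rewrite mulrCA ler_piMr ?(ltW e0)// ler_pdivrMr// mul1r lerDl.
- rewrite (le_trans kle)// lerD2l ler_pdivrMr// ler_peMr ?(ltW e0)//.
  by rewrite lerDr.
Qed.

Lemma dominated_near_prohorov eta mu nu : (0 <= eta)%R ->
  dominated_near (lambda * eta) eta mu nu -> (prohorov lambda mu nu <= eta)%R.
Proof.
by move=> eta0 H; apply: ge_inf; [exists 0%R => x []|split].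
Qed.

Lemma prohorov_le1 mu nu : mu setT = 1 -> (prohorov lambda mu nu <= 1)%R.
Proof.
move=> mu1; apply: dominated_near_prohorov => // A cA.
rewrite (le_trans (mass1_le1 _ _))//; first exact: measurable_closed.
by rewrite leeDr.
Qed.

End dominated_near.

(** * Comparison of integrals through superlevel sets *)

Section probability_of.
Context d {T : measurableType d} {R : realType}.
Variable mu : {measure set T -> \bar R}.
Hypothesis mu1 : mu setT = 1.

(** Repackages a measure of mass [1], such as a row of a kernel, as the
    [probability] for which the tail formula of the expectation is stated. *)
Definition probability_of of mu setT = 1 : set T -> \bar R := mu.

HB.instance Definition _ := Measure.copy (probability_of mu1) mu.
HB.instance Definition _ :=
  Measure_isProbability.Build _ _ _ (probability_of mu1) mu1.

End probability_of.

Section superlevel_sets.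
Context d {T : measurableType d} {R : realType}.
Implicit Types (mu nu : {measure set T -> \bar R}) (f g : T -> R).

Let leb : {measure set _ -> \bar R} := @lebesgue_measure R.

Lemma measurable_superlevel f (s : R) : measurable_fun setT f ->
  measurable [set x | (s < f x)%R].
Proof.
move=> mf; rewrite (_ : [set x | _] = setT `&` f @^-1` `]s, +oo[); first exact: mf.
by rewrite setTI; apply/seteqP; split=> x /=; rewrite in_itv/= andbT.
Qed.

Lemma measurable_tail mu f : mu setT = 1 -> measurable_fun setT f ->
  measurable_fun setT (fun s : R => mu [set x | (s < f x)%R]).
Proof.
move=> mu1 mf.
pose P : probability T R := probability_of mu1.
pose X : {RV P >-> R} := HB.pack f (isMeasurableFun.Build _ _ _ _ _ mf).
rewrite [X in measurable_fun _ X](_ : _ = ccdf X); first exact: ccdf_measurable.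
apply/funext => s; rewrite /ccdf /= /pushforward /=; congr (mu _).
by apply/seteqP; split => x /=; rewrite in_itv/= andbT.
Qed.

Lemma integral_tail mu f : mu setT = 1 -> measurable_fun setT f ->
  (forall x, 0 <= f x)%R ->
  \int[mu]_x (f x)%:E = \int[leb]_(s in `[0%R, +oo[) mu [set x | (s < f x)%R].
Proof.
move=> mu1 mf f0.
pose P : probability T R := probability_of mu1.
pose X : {RV P >-> R} := HB.pack f (isMeasurableFun.Build _ _ _ _ _ mf).
have := @ge0_expectation_ccdf _ _ _ P X f0.
rewrite expectation_def => ->; apply: eq_integral => s _.
rewrite /ccdf /= /pushforward /=; congr (mu _).
by apply/seteqP; split => x /=; rewrite in_itv/= andbT.
Qed.

(** For [s >= D] the superlevel set of [f] is empty, so the defect [b] is paid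
    only over an interval of length [D]. *)
Lemma le_integral_tail mu nu f g (D b : R) :
  mu setT = 1 -> nu setT = 1 ->
  measurable_fun setT f -> measurable_fun setT g ->
  (forall x, 0 <= f x <= D)%R -> (forall x, 0 <= g x)%R -> (0 <= b)%R ->
  (forall s, (0 <= s)%R ->
    mu [set x | (s < f x)%R] <= nu [set x | (s < g x)%R] + b%:E) ->
  \int[mu]_x (f x)%:E <= \int[nu]_x (g x)%:E + (D * b)%:E.
Proof.
move=> mu1 nu1 mf mg f0D g0 b0 H.
have f0 x : (0 <= f x)%R by case/andP: (f0D x).
have fD x : (f x <= D)%R by case/andP: (f0D x).
have D0 : (0 <= D)%R := le_trans (f0 point) (fD point).
(* The defect as a function of the level. *)
pose c := (cst b%:E \_ `[0%R, D[) : R -> \bar R.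
have c0 s : 0 <= c s by apply: erestrict_ge0 => ? _; rewrite lee_fin.
have mc : measurable_fun setT c.
  exact/(measurable_restrictT _ _).1/measurable_cst.
have intc : \int[leb]_(s in `[0%R, +oo[) c s = (D * b)%:E.
  rewrite -integral_mkcondr (_ : _ `&` _ = `[0%R, D[%classic); last first.
    apply/seteqP; split=> s /=; rewrite !in_itv/= ?andbT; first by case.
    by move=> /[dup] ? /andP[].
  rewrite integral_cst//= lebesgue_measure_itv/= lte_fin oppr0 adde0.
  by case: ltgtP D0 => // [_|<-] _; rewrite ?mul0r ?mule0// -EFinM mulrC.
rewrite !integral_tail// -intc.
have mS (h : T -> R) (m : {measure set T -> \bar R}) :
    m setT = 1 -> measurable_fun setT h ->
    measurable_fun (`[0%R, +oo[ : set R) (fun s : R => m [set x | (s < h x)%R]).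
  by move=> m1 mh; apply: measurable_funTS; exact: measurable_tail.
rewrite -ge0_integralD//; [|exact: mS|exact: measurable_funTS].
apply: ge0_le_integral => //.
- exact: mS.
- by apply: emeasurable_funD => //; [exact: mS|exact: measurable_funTS].
move=> s; rewrite /= in_itv/= andbT => s0.
have [sD|Ds] := ltP s D.
  by rewrite /c patchE mem_set ?H//= in_itv/= s0.
rewrite (_ : [set x | _] = set0) ?measure0 ?adde_ge0//.
by apply/seteqP; split=> x //=; rewrite ltNge (le_trans (fD x)).
Qed.

End superlevel_sets.

(** * Lipschitz kernels *)

Section kernel_values.
Context d {X : measurableType d} d' {Y : measurableType d'} {R : realType}.
Variable Q : R.-pker X ~> Y.

Lemma kernel_fin_num x (A : set Y) : measurable A -> Q x A \is a fin_num.
Proof.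
move=> mA; rewrite ge0_fin_numE// (le_lt_trans (mass1_le1 _ mA)) ?ltry//.
exact: prob_kernel.
Qed.

Lemma measurable_fine_kernel (A : set Y) : measurable A ->
  measurable_fun setT (fun x => fine (Q x A)).
Proof.
by move=> mA; apply: measurableT_comp => //; exact: measurable_kernel.
Qed.

Lemma integral_kernel_fine (mu : {measure set X -> \bar R}) (A : set Y) :
  measurable A -> \int[mu]_x Q x A = \int[mu]_x (fine (Q x A))%:E.
Proof.
by move=> mA; apply: eq_integral => x _; rewrite fineK// kernel_fin_num.
Qed.

End kernel_values.

Section lipschitz_kernel.
Context {R : realType} {T : pointedMetricType R}.
Implicit Types (Q : R.-pker borel T ~> borel T).
Implicit Types (mu nu sigma : {measure set (borel T) -> \bar R}).

Definition lipschitz_kernel (a b : R) Q := forall x x' : T,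
  dominated_near (a * mdist x x') (b * mdist x x') (Q x) (Q x').

(** One step of a Lipschitz kernel, with [sigma] the image of [nu].  If [y] is
    within [r] of a point [x] with [Q x A > s], the Lipschitz condition bounds
    [Q x A] by [Q y B + c * r], where [B] is the enlargement of [A] by
    [a * r].  So the superlevel sets of [x |-> Q x A], after enlargement by [r],
    lie, up to arbitrarily small slack in [r], in those of
    [y |-> Q y B + c * r]. *)
Lemma dominated_near_push (a c r b : R) Q mu nu sigma :
  (0 <= a)%R -> (0 <= c)%R -> (0 <= r)%R -> (0 <= b)%R ->
  mu setT = 1 -> nu setT = 1 -> sigma setT = 1 ->
  lipschitz_kernel a c Q -> dominated_near r b mu nu ->
  (forall B, measurable B -> \int[nu]_x Q x B = sigma B) ->
  forall A, closed A ->
  \int[mu]_x Q x A <= sigma (enlargement A (a * r)) + (b + c * r)%:E.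
Proof.
move=> a0 c0 r0 b0 mu1 nu1 sigma1 lipQ munu nuQ A cA.
apply: le_enlargement_slack => // e e0.
(* A point of the enlargement of radius [r] is only known to be at a distance
   less than [r'] from some point of the set, for each [r' > r]; this [r'] keeps
   [a * r'] and [c * r'] within [e] of their targets. *)
have ac0 : (0 < a + c + 1)%R by rewrite ltr_wpDl// addr_ge0.
pose e' := (e / (a + c + 1))%R.
have e'0 : (0 < e')%R by rewrite divr_gt0.
pose r' := (r + e')%R.
have r'0 : (0 <= r')%R by rewrite addr_ge0// ltW.
have ac_le (k : R) : (0 <= k)%R -> (k <= a + c + 1)%R ->
    (k * r' <= k * r + e)%R.
  move=> k0 kac; rewrite mulrDr lerD2l /e' mulrCA ler_piMr ?(ltW e0)//.
  by rewrite ler_pdivrMr// mul1r.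
have ar' : (a * r' <= a * r + e)%R by apply: ac_le; lra.
have cr' : (c * r' <= c * r + e)%R by apply: ac_le; lra.
pose B := enlargement A (a * r').
have mA : measurable (A : set (borel T)) := measurable_closed cA.
have mB : measurable (B : set (borel T)) := measurable_enlargement A (a * r').
pose f (x : borel T) := fine (Q x A).
pose g (x : borel T) := (fine (Q x B) + c * r')%R.
have mf : measurable_fun setT f by exact: measurable_fine_kernel.
have mg : measurable_fun setT g.
  by apply: measurable_funD => //; exact: measurable_fine_kernel.
have fg x y : (mdist y x < r')%R -> (f x <= g y)%R.
  rewrite metric_sym => yx; rewrite -lee_fin /f /g EFinD !fineK ?kernel_fin_num//.
  apply: (le_trans (lipQ x y A cA)); apply: leeD; last first.
    by rewrite lee_fin ler_wpM2l// ltW.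
  apply: le_measure; rewrite ?inE//; first exact: measurable_enlargement.
  by apply: enlargement_le; rewrite ler_wpM2l// ltW.
have g0 x : (0 <= g x)%R by rewrite addr_ge0 ?mulr_ge0// fine_ge0.
have f01 x : (0 <= f x <= 1)%R.
  rewrite fine_ge0//= -lee_fin fineK ?kernel_fin_num// mass1_le1//.
  exact: prob_kernel.
have : \int[mu]_x (f x)%:E <= \int[nu]_x (g x)%:E + (1 * b)%:E.
  apply: le_integral_tail => // s s0.
  set S := [set x | (s < f x)%R].
  have mS : measurable (S : set (borel T)).
    exact: measurable_superlevel.
  (* Superlevel sets need not be closed; taking the closure only costs an
     enlargement by [0]. *)
  apply: (@le_trans _ _ (mu (closure S))).
    apply: le_measure; rewrite ?inE//; last exact: subset_closure.
    by apply: measurable_closed; exact: closed_closure.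
  apply: (le_trans (munu _ (@closed_closure _ S))).
  rewrite leeD2r//; apply: le_measure; rewrite ?inE.
  - exact: measurable_enlargement.
  - exact: measurable_superlevel.
  - rewrite -enlargement0 => y /enlargementD/enlargementP/(_ _ e'0)[x Sx].
    by rewrite add0r => /fg; exact: lt_le_trans.
rewrite -(integral_kernel_fine Q mu mA) mul1r => /le_trans; apply.
rewrite (_ : \int[nu]_x (g x)%:E = sigma B + (c * r')%:E); last first.
  have mQ : measurable_fun setT (fun x => (fine (Q x B))%:E).
    by apply/measurable_EFinP; exact: measurable_fine_kernel.
  transitivity (\int[nu]_x ((fine (Q x B))%:E + (cst (c * r')%:E) x)).
    by apply: eq_integral => x _; rewrite -EFinD.
  rewrite ge0_integralD//; [|by move=> x _; rewrite /= lee_fin ?mulr_ge0 ?fine_ge0..].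
  rewrite integral_cst// nu1 mule1; congr (_ + _).
  by rewrite -nuQ// integral_kernel_fine.
rewrite -addeA leeD//.
  apply: le_measure; rewrite ?inE//; first exact: measurable_enlargement.
  exact: enlargement_le.
by rewrite -EFinD lee_fin; lra.
Qed.

End lipschitz_kernel.

Section integral_bounds.
Context d {T : measurableType d} {R : realType}.
Variable mu : {measure set T -> \bar R}.
Hypothesis mu1 : mu setT = 1.

Lemma integral_le_cst (f : T -> \bar R) (c : \bar R) :
  measurable_fun setT f -> (forall x, 0 <= f x) -> (forall x, f x <= c) ->
  \int[mu]_x f x <= c.
Proof.
move=> mf f0 fc; rewrite -[leRHS]mule1 -mu1 -integral_cst//.
by apply: ge0_le_integral => //; exact: measurable_cst.
Qed.

Lemma cst_le_integral (f : T -> \bar R) (c : \bar R) : 0 <= c ->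
  measurable_fun setT f -> (forall x, c <= f x) ->
  c <= \int[mu]_x f x.
Proof.
move=> c0 mf fc; rewrite -[leLHS]mule1 -mu1 -integral_cst//.
by apply: ge0_le_integral => //; exact: measurable_cst.
Qed.

End integral_bounds.

(** * Lipschitz constants of the powers of the kernel *)

Section kernel_powers_lipschitz.
Context {R : realType} {T : pointedMetricType R}.
Variable P : R.-pker borel T ~> borel T.
Variables lambda C : R.
Hypotheses (lambda_ge0 : (0 <= lambda)%R) (C_ge0 : (0 <= C)%R).
Hypothesis P_lipschitz : forall x x' : T,
  (prohorov lambda (P x) (P x') <= C * mdist x x')%R.

Let q : R := (lambda * C)%R.

Lemma kpowS d (X : measurableType d) (Q : R.-pker X ~> X) t x (A : set X) :
  kpow Q t.+1 x A = \int[Q x]_y kpow Q t y A.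
Proof. by []. Qed.

Definition geosum (s : R) (t : nat) : R := (\sum_(k < t) s ^+ k)%R.

Lemma geosumS s t : (geosum s t.+1 = geosum s t + s ^+ t)%R.
Proof. by rewrite /geosum big_ord_recr. Qed.

Lemma geosumSl s t : (geosum s t.+1 = 1 + s * geosum s t)%R.
Proof.
rewrite /geosum big_ord_recl expr0 mulr_sumr; congr (_ + _)%R.
by apply: eq_bigr => i _; rewrite -exprS.
Qed.

Lemma geosum_ge0 s t : (0 <= s)%R -> (0 <= geosum s t)%R.
Proof. by move=> s0; apply: sumr_ge0 => i _; exact: exprn_ge0. Qed.

Let q_ge0 : (0 <= q)%R. Proof. exact: mulr_ge0. Qed.

(** From two states at distance [d], the scale after [k + 1] steps is
    [C * d * q ^ k], and these scales add up to the defect. *)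
Lemma lipschitz_kernel_kpow t :
  lipschitz_kernel (q ^+ t) (C * geosum q t) (kpow P t).
Proof.
elim: t => [|t IH] x x' A cA.
  rewrite /geosum big_ord0 expr0 mul1r mulr0 mul0r adde0 /= /kdirac !diracE.
  have [xA|] := boolP (x \in A); last by rewrite lee_fin.
  rewrite mem_set//; apply/enlargementP => e e0; exists x; first by rewrite -inE.
  by rewrite metric_sym ltrDl.
have near : dominated_near (q * mdist x x') (C * mdist x x') (P x) (P x').
  rewrite /q -mulrA; apply: prohorov_dominated_near => //; exact: prob_kernel.
have d0 : (0 <= mdist x x')%R := mdist_ge0 x x'.
rewrite kpowS.
have := @dominated_near_push _ _ (q ^+ t) (C * geosum q t) _ _ (kpow P t)
  _ _ (kpow P t.+1 x') _ _ _ _ _ _ _ IH near _ A cA.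
rewrite (_ : q ^+ t.+1 * _ = q ^+ t * (q * mdist x x'))%R; last first.
  by rewrite exprSr mulrA.
rewrite (_ : C * geosum q t.+1 * _ =
  C * mdist x x' + C * geosum q t * (q * mdist x x'))%R; last first.
  by rewrite geosumSl; ring.
apply => //; rewrite ?mulr_ge0 ?exprn_ge0 ?geosum_ge0//; exact: prob_kernel.
Qed.

End kernel_powers_lipschitz.

(** * Comparison of the perturbed and unperturbed chains *)

Section extended_measures.
Context {R : realType} {T : pointedMetricType R} {A : set T} {A0 : A !=set0}.

Lemma measurable_trace_val : measurable_fun setT (@trace_val T A A0 :
  trace_borel A0 -> borel T).
Proof. by move=> _ B mB; rewrite setTI; exists B => //; rewrite setTI. Qed.

Lemma extend_mass1 (mu : {measure set (trace_borel A0) -> \bar R}) :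
  mu setT = 1 -> extend mu setT = 1.
Proof. by []. Qed.

Lemma integral_extend (mu : {measure set (trace_borel A0) -> \bar R})
    (f : borel T -> \bar R) :
  measurable_fun setT f -> (forall y, 0 <= f y) ->
  \int[extend mu]_y f y = \int[mu]_y f (trace_val A0 y).
Proof.
move=> mf f0.
rewrite -[RHS](@ge0_integral_pushforward _ _ _ _ _ _ measurable_trace_val mu setT f)//.
Qed.

End extended_measures.

Section perturbation.
Context {R : realType} {T : pointedMetricType R} {A : set T} {A0 : A !=set0}.
Variable P : R.-pker borel T ~> borel T.
Variable hP : R.-pker trace_borel A0 ~> trace_borel A0.
Variables lambda C delta : R.
Hypotheses (lambda_ge0 : (0 <= lambda)%R) (C_ge0 : (0 <= C)%R).
Hypothesis delta_ge0 : (0 <= delta)%R.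
Hypothesis hP_close : forall x : trace_borel A0,
  (prohorov lambda (extend (hP x)) (P (trace_val A0 x)) <= delta)%R.
Hypothesis P_lipschitz : forall x x' : T,
  (prohorov lambda (P x) (P x') <= C * mdist x x')%R.

Let q : R := (lambda * C)%R.

Lemma measurable_preimage_trace (B : set (borel T)) : measurable B ->
  measurable (trace_val A0 @^-1` B : set (trace_borel A0)).
Proof. by move=> mB; rewrite -[X in measurable X]setTI; exact: measurable_trace_val. Qed.

(** Two replacements turn [hP ^ (t + 1)] into [P ^ (t + 1)].  Replacing the last
    [t] steps costs the induction hypothesis, averaged over the first step;
    replacing the first step costs [delta], propagated by the Lipschitz
    constants of [P ^ t]. *)
Lemma dominated_near_kpow t x :
  dominated_near (lambda * (delta * geosum q t))
    (delta * \sum_(s < t) geosum q s.+1)%R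
    (extend (kpow hP t x)) (kpow P t (trace_val A0 x)).
Proof.
have q_ge0 : (0 <= q)%R by exact: mulr_ge0.
elim: t x => [|t IH] x B cB.
  by rewrite /geosum !big_ord0 !mulr0 adde0 enlargement_closed0.
set r := (lambda * (delta * geosum q t))%R in IH.
set b := (delta * _)%R in IH.
pose D := enlargement B r.
have mD : measurable (D : set (borel T)) by exact: measurable_enlargement.
have mB : measurable (B : set (borel T)) by exact: measurable_closed.
have b0 : (0 <= b)%R by rewrite mulr_ge0// sumr_ge0// => i _; exact: geosum_ge0.
have mPD : measurable_fun setT (kpow P t ^~ D) by exact: measurable_kernel.
have mPDtrace : measurable_fun setT
    (fun y : trace_borel A0 => kpow P t (trace_val A0 y) D).
  exact: measurableT_comp mPD measurable_trace_val.
have mhPB : measurable_fun setT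
    (fun y => kpow hP t y (trace_val A0 @^-1` B)).
  by apply: measurable_kernel; exact: measurable_preimage_trace.
(* The last [t] steps are replaced first. *)
have step1 : extend (kpow hP t.+1 x) B <=
    \int[extend (hP x)]_z kpow P t z D + b%:E.
  rewrite [leLHS]/extend kpowS.
  apply: (@le_trans _ _ (\int[hP x]_y (kpow P t (trace_val A0 y) D + cst b%:E y))).
    apply: ge0_le_integral => //.
      exact: emeasurable_funD.
    by move=> y _; exact: IH.
  rewrite ge0_integralD//.
  by rewrite integral_extend// integral_cst// prob_kernel mule1.
have near : dominated_near (lambda * delta) delta (extend (hP x)) (P (trace_val A0 x)).
  apply: prohorov_dominated_near => //; last exact: prob_kernel.
  by apply: extend_mass1; exact: prob_kernel.
apply: (le_trans step1).
have := @dominated_near_push _ _ (q ^+ t) (C * geosum q t) _ _ (kpow P t)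
  _ _ (kpow P t.+1 (trace_val A0 x)) _ _ _ _ _ _ _
  (lipschitz_kernel_kpow lambda_ge0 C_ge0 P_lipschitz t) near _ D
  (@closed_enlargement _ _ B r).
have -> : (delta + C * geosum q t * (lambda * delta) = delta * geosum q t.+1)%R.
  by rewrite geosumSl /q; ring.
move=> push.
rewrite big_ord_recr/= mulrDr -/b EFinD [b%:E + _]addeC addeA leeD2r//.
apply: (le_trans (push _ _ _ _ _ _ _ _)) => //;
  rewrite ?mulr_ge0 ?exprn_ge0 ?geosum_ge0//.
- by apply: extend_mass1; exact: prob_kernel.
- exact: prob_kernel.
- exact: prob_kernel.
rewrite leeD2r//; apply: le_measure; rewrite ?inE; try exact: measurable_enlargement.
move=> y /enlargementD; rewrite (_ : r + _ = lambda * (delta * geosum q t.+1))%R//.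
by rewrite /r geosumS; ring.
Qed.

End perturbation.

(** * Inner regularity of Borel probability measures *)

Section regularity.
Context {R : realType} {T : pointedMetricType R}.
Variable mu : {measure set (borel T) -> \bar R}.
Hypothesis mu1 : mu setT = 1.

(** Requiring an open set from outside as well makes the property stable under
    complements, hence a sigma-algebra. *)
Let regular (B : set T) := forall e : R, (0 < e)%R -> exists F U : set T,
  [/\ closed F, open U, F `<=` B, B `<=` U & mu (U `\` F) <= e%:E].

Let measurable_open (U : set T) : open U -> measurable (U : set (borel T)).
Proof. by move=> oU; exact: sub_sigma_algebra. Qed.

Let measurable_gap (F U : set T) : closed F -> open U ->
  measurable (U `\` F : set (borel T)).
Proof.
by move=> cF oU; apply: measurableD; [exact: measurable_open|exact: measurable_closed].
Qed.

Let regularC B : regular B -> regular (~` B).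
Proof.
move=> rB e /rB[F [U [cF oU FB BU UF]]]; exists (~` U), (~` F); split.
- exact: open_closedC.
- exact: closed_openC.
- exact: subsetC.
- exact: subsetC.
- by rewrite setDE setCK setIC -setDE.
Qed.

(** Small open neighbourhoods of a closed set have almost the same measure,
    since its enlargements decrease to it. *)
Let regular_closed A : closed A -> regular A.
Proof.
move=> cA e e0.
have mA : measurable (A : set (borel T)) := measurable_closed cA.
have fA : mu A \is a fin_num.
  by rewrite ge0_fin_numE// (le_lt_trans (mass1_le1 mu1 mA)) ?ltry.
have [s s0 As] : exists2 s : R, (0 < s)%R & mu (enlargement A s) <= mu A + e%:E.
  apply: contrapT => nex.
  have : mu A + e%:E <= mu (enlargement A 0) + 0%:E.
    apply: le_enlargement_slack => // s s0; rewrite !add0r leNgt.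
    apply/negP => lt_e; apply: nex; exists s => //.
    by rewrite (le_trans _ (ltW lt_e))// leeDl// lee_fin ltW.
  by rewrite enlargement_closed0// adde0 leNgt lteDl// lte_fin e0.
exists A, (enlargement A s)°; split => //.
- exact: open_interior.
- move=> x Ax; apply/nbhs_ballP; exists s => //= y.
  rewrite ballEmdist /= => xy; apply/enlargementP => e' e'0; exists x => //.
  by rewrite metric_sym (lt_trans xy)// ltrDl.
- have mE := measurable_enlargement A s.
  apply: (@le_trans _ _ (mu (enlargement A s `\` A))).
    apply: le_measure; rewrite ?inE.
    + by apply: measurable_gap => //; exact: open_interior.
    + exact: measurableD.
    + by apply: setSD; exact: interior_subset.
  rewrite measureD//; last by rewrite (le_lt_trans (mass1_le1 mu1 mE)) ?ltry.
  rewrite (setIidr (sub_enlargement (ltW s0))).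
  by rewrite leeBlDl.
Qed.

(** The union of all the inner sets is not closed: it is replaced by a finite
    union, which exhausts its measure. *)
Let regular_bigcup (B : (set T)^nat) :
  (forall n, regular (B n)) -> regular (\bigcup_n B n).
Proof.
move=> rB e e0.
have e20 : (0 < e / 2)%R by rewrite divr_gt0.
have eps_gt0 n : (0 < e / 2 / (2 ^ n.+1)%:R :> R)%R.
  by rewrite divr_gt0// ltr0n expn_gt0.
have /choice[FU FUP] : forall n, exists FU : set T * set T,
    [/\ closed FU.1, open FU.2, FU.1 `<=` B n, B n `<=` FU.2 &
      mu (FU.2 `\` FU.1) <= (e / 2 / (2 ^ n.+1)%:R)%:E].
  by move=> n; have [F [U H]] := rB n _ (eps_gt0 n); exists (F, U).
pose F n := (FU n).1; pose U n := (FU n).2.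
have cF n : closed (F n) by case: (FUP n).
have oU n : open (U n) by case: (FUP n).
pose G := \bigcup_n F n; pose V := \bigcup_n U n.
pose H N : set T := \bigcup_(i in `I_N) F i.
have cH N : closed (H N) by apply: closed_bigcup => //; exact: finite_II.
have oV : open V by apply: bigcup_open => n _; exact: oU.
have mG : measurable (G : set (borel T)).
  by apply: bigcupT_measurable => n; exact: measurable_closed.
pose W N : set (borel T) := V `\` H N.
have capE : \bigcap_N W N = V `\` G.
  apply/seteqP; split=> x.
    move=> xVH; split; first by case: (xVH 0%N).
    by move=> [n _ Fnx]; case: (xVH n.+1) => // _; apply; exists n => //=.
  by move=> [Vx nGx] N _; split=> // -[n _ Fnx]; apply: nGx; exists n.
have VG : mu (V `\` G) <= (e / 2)%:E.
  apply: (@le_trans _ _ (\sum_(n <oo) mu (U n `\` F n))).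
    apply: measure_sigma_subadditive.
    - by move=> n; exact: measurable_gap.
    - by apply: measurableD => //; exact: measurable_open.
    - by move=> x [[n _ Unx] nGx]; exists n => //; split=> // Fnx; apply: nGx; exists n.
  apply: (le_trans _ (epsilon_trick0 xpredT (ltW e20))).
  by apply: lee_nneseries => // n _; case: (FUP n).
have cvgV : mu (W N) @[N --> \oo] --> mu (V `\` G).
  rewrite -capE; apply: (nonincreasing_cvg_mu (F := W)).
  - by rewrite (le_lt_trans (mass1_le1 mu1 _)) ?ltry//; exact: measurable_gap.
  - by move=> N; exact: measurable_gap.
  - by apply: bigcapT_measurable => N; exact: measurable_gap.
  - move=> m n mn; apply/subsetPset; apply: setDS => x [i /= im Fix].
    by exists i => //=; exact: leq_trans mn.
have [N HN] : exists N, mu (W N) <= e%:E.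
  apply: contrapT => nex.
  have : e%:E <= mu (V `\` G).
    apply: cvge_ge cvgV; near=> N; rewrite leNgt; apply/negP => lt_e.
    by apply: nex; exists N; exact: ltW.
  by move=> /le_trans/(_ VG); rewrite lee_fin; lra.
exists (H N), V; split => //.
- by move=> x [n _ Fnx]; exists n => //; case: (FUP n) => _ _ + _ _; exact.
- by move=> x [n _ Bnx]; exists n => //; case: (FUP n) => _ _ _ + _; exact.
Unshelve. all: by end_near. Qed.

Lemma closed_inner_approx (B : set (borel T)) (e : R) : measurable B ->
  (0 < e)%R -> exists F : set T, [/\ closed F, F `<=` B & mu (B `\` F) <= e%:E].
Proof.
move=> mB e0; have /(_ e e0)[F [U [cF oU FB BU UF]]] : regular B.
  apply: (smallest_sub _ _ mB).
    split=> [|A rA|A rA].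
    - by apply: regular_closed; exact: closed0.
    - by rewrite setTD; exact: regularC.
    - exact: regular_bigcup.
  by move=> U oU; rewrite -[U]setCK; apply/regularC/regular_closed/open_closedC.
exists F; split => //; apply: le_trans UF; apply: le_measure; rewrite ?inE.
- by apply: measurableD => //; exact: measurable_closed.
- exact: measurable_gap.
- exact: setSD.
Qed.

End regularity.

(** * Contraction in total variation *)

Section total_variation.
Context d {T : measurableType d} {R : realType}.
Implicit Types (mu nu : {measure set T -> \bar R}).

(** One-sided: for probability measures, passing to complements gives the
    reverse inequality. *)
Definition tv_le (eta : R) mu nu :=
  forall B, measurable B -> mu B <= nu B + eta%:E.

(** Subtracting its infimum from [x |-> Q x A] leaves a function with values in
    [[0, D]] and changes both integrals by the same amount; the factor [D] is
    what makes the oscillation submultiplicative. *)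
Lemma tv_le_push d' (Y : measurableType d') (Q : R.-pker T ~> Y) (A : set Y)
    (eta D : R) mu nu :
  mu setT = 1 -> nu setT = 1 -> (0 <= eta)%R -> measurable A ->
  (forall x x', Q x A <= Q x' A + D%:E) -> tv_le eta mu nu ->
  \int[mu]_x Q x A <= \int[nu]_x Q x A + (D * eta)%:E.
Proof.
move=> mu1 nu1 eta0 mA oscQ munu.
pose f x := fine (Q x A).
have fE x : (f x)%:E = Q x A by rewrite fineK// kernel_fin_num.
have f0 x : (0 <= f x)%R by exact: fine_ge0.
have mf : measurable_fun setT f by exact: measurable_fine_kernel.
have oscf x x' : (f x <= f x' + D)%R by rewrite -lee_fin EFinD !fE.
pose m := inf (range f).
have lbf : has_lbound (range f) by exists 0%R => _ [x _ <-].
have nef : range f !=set0 by exists (f point), point.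
have mle x : (m <= f x)%R by apply: ge_inf => //; exists x.
have m0 : (0 <= m)%R by apply: lb_le_inf => // _ [x _ <-].
have lem x : (f x - D <= m)%R.
  by apply: lb_le_inf => // _ [x' _ <-]; rewrite lerBlDr.
pose h x := (f x - m)%R.
have h0 x : (0 <= h x)%R by rewrite subr_ge0.
have mh : measurable_fun setT h by exact: measurable_funB.
have intE (rho : {measure set T -> \bar R}) : rho setT = 1 ->
    \int[rho]_x Q x A = \int[rho]_x (h x)%:E + m%:E.
  move=> rho1; rewrite -[m%:E]mule1 -rho1 -integral_cst// -ge0_integralD//.
  - by apply: eq_integral => x _; rewrite -EFinD subrK fE.
  - by move=> x _; rewrite lee_fin.
  - exact/measurable_EFinP.
rewrite (intE mu)// (intE nu)// addeAC leeD2r//.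
apply: le_integral_tail => //.
  by move=> x; rewrite h0 /=; have := lem x; rewrite /h; lra.
by move=> s s0; apply: munu; exact: measurable_superlevel.
Qed.

(** The Chapman-Kolmogorov equation. *)
Lemma kpowD (P : R.-pker T ~> T) m n x A : measurable A ->
  kpow P (m + n) x A = \int[kpow P m x]_y kpow P n y A.
Proof.
move=> mA; elim: m x => [|m IH] x.
  by rewrite add0n /= integral_dirac// ?diracE ?mem_set ?mul1e//;
    exact: measurable_kernel.
rewrite addSn kpowS.
transitivity (\int[P x]_z \int[kpow P m z]_y kpow P n y A).
  by apply: eq_integral => z _; exact: IH.
pose k := @kernel.kernel_snd _ _ _ T T T R (kpow P m).
have := @integral_kcomp _ _ _ T T T R P k x (kpow P n ^~ A)
  (fun=> measure_ge0 _ _) (measurable_kernel _ _ mA).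
by move=> /esym ->.
Qed.

End total_variation.

Section mixing.
Context {R : realType} {T : pointedMetricType R}.
Variable P : R.-pker borel T ~> borel T.

(** The metric only compares closed sets; inner regularity of [mu] transfers the
    inequality to Borel sets. *)
Lemma tv_tv_le (eta : R) (mu nu : {measure set (borel T) -> \bar R}) :
  mu setT = 1 -> nu setT = 1 -> (tv mu nu <= eta)%R -> tv_le eta mu nu.
Proof.
move=> mu1 nu1 /(prohorov_dominated_near (lexx 0%R) mu1 nu1).
rewrite mul0r => munu B mB; apply/lee_addgt0Pr => e e0.
have [F [cF FB BF]] := closed_inner_approx mu1 mB e0.
have mF : measurable (F : set (borel T)) := measurable_closed cF.
rewrite -(setDUK FB) measureU//; [|exact: measurableD|by rewrite setDIK].
apply: leeD => //; apply: (le_trans (munu F cF)).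
rewrite enlargement_closed0// leeD2r//.
by apply: le_measure; rewrite ?inE//; rewrite setDUK.
Qed.

Variable tau : nat.
Variable eta : R.
Hypothesis eta_ge0 : (0 <= eta)%R.
Hypothesis P_tau : forall x x' : borel T,
  (tv (kpow P tau x) (kpow P tau x') <= eta)%R.

Lemma tv_le_kpow_mul k (x x' : borel T) :
  tv_le (eta ^+ k) (kpow P (k * tau) x) (kpow P (k * tau) x').
Proof.
elim: k x x' => [|k IH] x x' A mA.
  rewrite expr0 (le_trans (mass1_le1 _ mA))//; first exact: prob_kernel.
  by rewrite leeDr.
rewrite mulSn !kpowD// exprSr; apply: tv_le_push => //; try exact: prob_kernel.
  by move=> y y'; exact: IH.
by apply: tv_tv_le => //; exact: prob_kernel.
Qed.

(** A later power of the kernel is a mixture of the rows of [kpow P (k * tau)]. *)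
Lemma tv_le_kpow k n (x x' : borel T) : (k * tau <= n)%N ->
  tv_le (eta ^+ k) (kpow P (k * tau) x) (kpow P n x').
Proof.
move=> /subnK <- A mA.
pose f y := kpow P (k * tau) y A.
have mf : measurable_fun setT f by exact: measurable_kernel.
have eta0 : 0 <= (eta ^+ k)%:E by rewrite lee_fin exprn_ge0.
set j := (n - k * tau)%N.
rewrite kpowD// -[(eta ^+ k)%:E]mule1 -(@prob_kernel _ _ _ _ _ (kpow P j) x').
rewrite -integral_cst// -ge0_integralD//.
apply: cst_le_integral => //; first exact: prob_kernel.
  exact: emeasurable_funD.
by move=> y; exact: tv_le_kpow_mul.
Qed.

(** Letting the later power in [tv_le_kpow] tend to [pi] bounds the distance of
    each row at time [k * tau] to [pi]; the rows at time [n] are mixtures of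
    these. *)
Lemma tv_le_kpow_limit k n (pi : probability (borel T) R) (x : borel T) :
  (k * tau <= n)%N -> tv (kpow P t x) pi @[t --> \oo] --> (0 : R)%R ->
  tv_le (eta ^+ k) (kpow P n x) pi.
Proof.
move=> kn cvgx A mA.
have le_pi y : kpow P (k * tau) y A <= pi A + (eta ^+ k)%:E.
  apply/lee_addgt0Pr => e e0.
  have /cvgr0Pnorm_le/(_ _ e0)[N _ HN] := cvgx.
  have tv_e : tv_le e (kpow P (maxn N (k * tau)) x) pi.
    apply: tv_tv_le; [exact: prob_kernel|exact: probability_setT|].
    by rewrite (le_trans (ler_norm _))//; apply: HN; exact: leq_maxl.
  apply: (le_trans (tv_le_kpow y x (leq_maxr N (k * tau)) mA)).
  by rewrite addeAC leeD2r//; exact: tv_e.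
rewrite -(subnK kn) kpowD//; apply: integral_le_cst => //.
- exact: prob_kernel.
- exact: measurable_kernel.
Qed.

End mixing.

(** * Persistence in time *)

Section convexity.
Context {R : realType} {T : pointedMetricType R} {A : set T} {A0 : A !=set0}.
Variable hP : R.-pker trace_borel A0 ~> trace_borel A0.

Lemma dominated_near_kpow_ge (r b : R) (nu : {measure set (borel T) -> \bar R})
    s t : (s <= t)%N ->
  (forall x, dominated_near r b (extend (kpow hP s x)) nu) ->
  forall x, dominated_near r b (extend (kpow hP t x)) nu.
Proof.
move=> /subnK <- H; elim: (t - s)%N => // n IH x B cB.
have mB : measurable (B : set (borel T)) := measurable_closed cB.
rewrite addSn /= /extend kpowS; apply: integral_le_cst => //.
- exact: prob_kernel.
- by apply: measurable_kernel; exact: measurable_preimage_trace.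
- by move=> y; exact: IH.
Qed.

End convexity.

(** * Numerical bounds *)

Section total_error.
Context {R : realType}.
Implicit Types q : R.
Local Open Scope ring_scope.

Lemma geosum_mulB q n : (1 - q) * geosum q n = 1 - q ^+ n.
Proof. by have := subrX1 q n; rewrite -/(geosum q n); lra. Qed.

Lemma sum_geosum_lt1 q t : 0 <= q -> q < 1 ->
  (1 - q) * \sum_(s < t) geosum q s.+1 <= t%:R.
Proof.
move=> q0 q1; rewrite mulr_sumr -[t in leRHS]card_ord -sumr_const.
by apply: ler_sum => s _; rewrite geosum_mulB gerBl exprn_ge0.
Qed.

Lemma sum_geosum_eq1 t : 2 * \sum_(s < t) geosum (1 : R) s.+1 = t%:R * (t%:R + 1).
Proof.
elim: t => [|t IH]; first by rewrite big_ord0 mulr0 mul0r.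
rewrite big_ord_recr/= mulrDr IH.
have -> : geosum (1 : R) t.+1 = t.+1%:R.
  by rewrite /geosum; under eq_bigr do rewrite expr1n; rewrite sumr_const card_ord.
by rewrite -natr1; ring.
Qed.

Lemma sum_geosum_gt1 q t : 1 < q ->
  (q - 1) ^+ 2 * \sum_(s < t) geosum q s.+1 <= q ^+ t.+1.
Proof.
move=> q1; have q0 : 0 <= q by rewrite ltW// (lt_trans ltr01).
have q10 : 0 <= q - 1 by rewrite subr_ge0 ltW.
have geo n : (q - 1) * geosum q n <= q ^+ n.
  have -> : (q - 1) * geosum q n = q ^+ n - 1.
    by have := geosum_mulB q n; lra.
  by rewrite gerBl.
rewrite expr2 -mulrA exprS.
apply: (@le_trans _ _ ((q - 1) * (q * geosum q t))).
  rewrite ler_wpM2l// mulr_sumr /geosum mulr_sumr; apply: ler_sum => s _.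
  by rewrite -exprS geo.
by rewrite mulrCA ler_wpM2l.
Qed.

Lemma geosum_le_sum q t : 0 <= q -> geosum q t <= \sum_(s < t) geosum q s.+1.
Proof.
case: t => [|t] q0; first by rewrite /geosum !big_ord0.
by rewrite big_ord_recr/= lerDr sumr_ge0// => s _; exact: geosum_ge0.
Qed.

Lemma le_ediv (a x y : R) : 0 < y -> (a%:E <= x%:E / y%:E)%E -> a * y <= x.
Proof.
by move=> y0; rewrite inver gt_eqF// -EFinM lee_fin ler_pdivlMr.
Qed.

(** For [t = 0] the first two divisors vanish and the hypotheses do not bound
    [delta], but then the sum is empty. *)
Lemma total_error_le q (delta eps : R) (t : nat) :
  0 <= q -> 0 <= delta -> 0 < eps ->
  (q < 1 -> (delta%:E <= ((1 - q) * eps)%:E / (2 * t%:R)%:E)%E) ->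
  (q = 1 -> (delta%:E <= eps%:E / (t%:R * (t%:R + 1))%:E)%E) ->
  (1 < q -> (delta%:E <= ((q - 1) ^+ 2 * eps)%:E / (2 * q ^+ t.+1)%:E)%E) ->
  delta * \sum_(s < t) geosum q s.+1 <= eps / 2.
Proof.
move=> q0 d0 e0 Hlt Heq Hgt; case: t => [|t] in Hlt Heq Hgt *.
  by rewrite big_ord0 mulr0 divr_ge0// ltW.
have t0 : 0 < t.+1%:R :> R by rewrite ltr0n.
have S0 : 0 <= \sum_(s < t.+1) geosum q s.+1.
  by rewrite sumr_ge0// => s _; exact: geosum_ge0.
set S := \sum_(s < t.+1) _ in S0 *.
have [q1|q1|q1] := ltgtP q 1.
- have q10 : 0 < 1 - q by rewrite subr_gt0.
  have /le_ediv := Hlt q1; rewrite mulr_gt0// => /(_ isT) H.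
  have := sum_geosum_lt1 t.+1 q0 q1; rewrite -/S => HS.
  rewrite -(ler_pM2l q10) mulrCA (le_trans (ler_wpM2l d0 HS))//.
  by move: H; lra.
- have q10 : 0 < (q - 1) ^+ 2 by rewrite exprn_gt0// subr_gt0.
  have qt0 : 0 < q ^+ t.+2 by rewrite exprn_gt0// (lt_trans ltr01).
  have /le_ediv := Hgt q1; rewrite mulr_gt0// => /(_ isT) H.
  have := sum_geosum_gt1 t.+1 q1; rewrite -/S => HS.
  rewrite -(ler_pM2l q10) mulrCA (le_trans (ler_wpM2l d0 HS))//.
  by move: H; lra.
- have HS : 2 * S = t.+1%:R * (t.+1%:R + 1) by rewrite /S q1 sum_geosum_eq1.
  have /le_ediv := Heq q1; rewrite mulr_gt0 ?addr_gt0// => /(_ isT).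
  by rewrite -HS; lra.
Qed.

(** [k = s %/ tau] works because [k + 1 >= ln (2 * e / eps)], the factor [e]
    compensating for the rounding.  If [tau = 0], any large [k] is allowed. *)
Lemma mixing_time (eps : R) (tau s : nat) : 0 < eps ->
  ln (2 * expR 1 / eps) * tau%:R <= s%:R ->
  exists2 k, (k * tau <= s)%N & (expR 1)^-1 ^+ k <= eps / 2.
Proof.
move=> e0; set L := ln _ => Ls.
have [k ks Lk] : exists2 k, (k * tau <= s)%N & L <= k.+1%:R.
  have [tau0|tau0] := posnP tau.
    exists (Num.bound `|L|); first by rewrite tau0 muln0.
    rewrite (le_trans (ler_norm _))// (le_trans (ltW (archi_boundP (normr_ge0 L))))//.
    by rewrite ler_nat.
  exists (s %/ tau)%N; first exact: leq_divM.
  have tau0' : 0 < tau%:R :> R by rewrite ltr0n.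
  rewrite -(ler_pM2r tau0') (le_trans Ls)// -natrM ler_nat mulSn addnC.
  by rewrite ltnW// {1}(divn_eq s tau) ltn_add2l ltn_pmod.
exists k => //.
have x0 : 0 < 2 * expR 1 / eps :> R by rewrite divr_gt0// mulr_gt0// expR_gt0.
have : 2 * expR 1 / eps <= expR k.+1%:R :> R.
  by rewrite -[leLHS](lnK x0) ler_expR.
rewrite -[k.+1%:R]natr1 expRD ler_pdivrMr// mulrAC ler_pM2r ?expR_gt0// => H.
rewrite -expRN -expRM_natl mulrN mulr1 expRN ler_pdivlMr// mulrC.
by rewrite ler_pdivrMr ?expR_gt0// mulrC.
Qed.

End total_error.

(** * Approximation of the stationary distribution *)

Local Close Scope ereal_scope.

Theorem theorem2 (R : realType) (Omega : pointedMetricType R)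
  (Omega_separable : separable Omega)
  (hOmega : set Omega) (hOmega0 : hOmega !=set0)
  (P : R.-pker (borel Omega) ~> (borel Omega))
  (hP : R.-pker (trace_borel hOmega0) ~> (trace_borel hOmega0))
  (eps : R) (eps_gt0 : 0 < eps)
  (lambda C delta : R)
  (lambda_ge0 : 0 <= lambda) (C_ge0 : 0 <= C) (delta_ge0 : 0 <= delta)
  (hP_close : forall x : trace_borel hOmega0,
     prohorov lambda (extend (hP x)) (P (trace_val hOmega0 x)) <= delta)
  (P_lipschitz : forall x x' : Omega,
     prohorov lambda (P x) (P x') <= C * mdist x x')
  (pi : probability (borel Omega) R) (P_ergodic : ergodic P pi)
  (tau1 : nat) (tau1_threshold : variation_threshold P tau1) :
  (* [t_eps] may be negative when [eps] is large; the extended-real division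
     satisfies [r%:E / 0 = +oo] for [0 < r] *)
  let t_eps : int := Num.ceil (ln (2 * expR 1 / eps) * tau1%:R) in
  (lambda * C < 1 ->
     (delta%:E <= ((1 - lambda * C) * eps)%:E / (2 * t_eps%:~R)%:E)%E) ->
  (lambda * C = 1 ->
     (delta%:E <= eps%:E / (t_eps%:~R * (t_eps%:~R + 1))%:E)%E) ->
  (1 < lambda * C ->
     (delta%:E <=
        ((lambda * C - 1) ^+ 2 * eps)%:E / (2 * (lambda * C) ^ (t_eps + 1))%:E)%E) ->
  forall (x : trace_borel hOmega0) (t : nat), t_eps <= t%:Z ->
    prohorov lambda (extend (kpow hP t x)) pi <= eps.
Proof.
move=> t_eps Hlt Heq Hgt x t le_t.
have hk1 y n : extend (kpow hP n y) setT = 1%E.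
  by apply: extend_mass1; exact: prob_kernel.
(* The Prohorov metric is at most [1]; below, [eps < 1] makes [t_eps]
   nonnegative. *)
have [eps1|eps1] := leP 1 eps.
  by apply: le_trans eps1; apply: prohorov_le1 => //; exact: hk1.
have L0 : 0 <= ln (2 * expR 1 / eps).
  rewrite ln_ge0// ler_pdivlMr// mul1r (le_trans (ltW eps1))//.
  have : 1 <= expR 1 :> R by rewrite -expR0 ler_expR.
  lra.
have t_eps0 : 0 <= t_eps.
  by rewrite ceil_ge0 (lt_le_trans _ (mulr_ge0 L0 (ler0n _ _)))// ltrN10.
have le_s : ln (2 * expR 1 / eps) * tau1%:R <= t_eps%:~R by exact: ceil_ge.
have [s t_epsE] : exists s : nat, t_eps = s.
  by exists `|t_eps|%N; rewrite gez0_abs.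
rewrite t_epsE in Hlt Heq Hgt le_t le_s.
have q0 : 0 <= lambda * C by exact: mulr_ge0.
set S := \sum_(s' < s) geosum (lambda * C) s'.+1.
have S_le : delta * S <= eps / 2.
  apply: total_error_le => // q1.
  by rewrite -[s.+1]addn1; exact: Hgt.
have geo_le : delta * geosum (lambda * C) s <= eps / 2.
  by apply: le_trans S_le; rewrite ler_wpM2l// geosum_le_sum.
have [k ks keps] := mixing_time eps_gt0 le_s.
have e10 : 0 <= (expR 1)^-1 :> R by rewrite invr_ge0 expR_ge0.
have P_pi y : dominated_near 0 (eps / 2) (kpow P s y) pi.
  move=> A cA; rewrite enlargement_closed0//.
  have mA : measurable (A : set (borel Omega)) := measurable_closed cA.
  have [_ cvgP] := P_ergodic; have [small _] := tau1_threshold.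
  apply: (le_trans (tv_le_kpow_limit e10 small ks (cvgP y) mA)).
  by rewrite leeD2l// lee_fin.
have hP_pi y : dominated_near (lambda * eps) eps (extend (kpow hP s y)) pi.
  have near := dominated_near_kpow lambda_ge0 C_ge0 delta_ge0 hP_close
    P_lipschitz s y.
  apply: (dominated_near_le _ _ (dominated_near_trans near (P_pi _))).
    by rewrite addr0 ler_wpM2l// (le_trans geo_le)//; lra.
  by rewrite [leRHS]splitr lerD2r.
apply: dominated_near_prohorov; first exact: ltW.
by apply: dominated_near_kpow_ge hP_pi _.
Qed.
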